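(* Let $p>1$ and let $G=(V,E)$ be a finite connected graph with vertex measure $\mu$ and symmetric edge measure $\omega$. Let $h\in C(V)$ and, for constants $c<0$, consider the equation $$\Delta_p u=c-he^{u}\quad\text{in } V \qquad (\ast_c)$$ for $u\in C(V)$. If $(\ast_c)$ has a solution for some $c<0$, then $\overline{h}<0$. On the contrary, if $\overline{h}<0$, then there exists a constant $c_-(h)\in[-\infty,0)$ depending only on $h$ (for the given $G,\mu,\omega,p$; in particular not on $c$) such that $(\ast_c)$ has a solution for every $c\in(c_-(h),0)$, but has no solution for any real $c<c_-(h)$.
   Context: $G=(V,E)$ is a finite connected graph with vertex set $V$ and edge set $E$; $i\sim j$ means that $i,j\in V$ are joined by an edge. $\mu:V\to(0,+\infty)$ is a fixed vertex measure and $\omega:E\to(0,+\infty)$ is a fixed edge measure, symmetric: $\omega_{ij}=\omega_{ji}$ for each edge $i\sim j$. $C(V)$ is the finite-dimensional vector space of all real functions on $V$. For $p>1$ the discrete $p$-Laplacian $\Delta_p:C(V)\to C(V)$ is $$\Delta_p f_i=\frac{1}{\mu_i}\sum_{j\sim i}\omega_{ij}|f_j-f_i|^{p-2}(f_j-f_i),\qquad i\in V,$$ where $|t|^{p-2}t$ is understood to be $0$ at $t=0$. For $f\in C(V)$, $\overline{f}=\big(\sum_{i\in V}\mu_i f_i\big)/\big(\sum_{i\in V}\mu_i\big)$ is the average of $f$ with respect to $\mu$. *)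

(* Defs.v *)
From mathcomp Require Import all_boot all_order all_algebra.
From mathcomp Require Import reals sequences exp.

Set Implicit Arguments.
Unset Strict Implicit.
Unset Printing Implicit Defensive.

Import Order.TTheory GRing.Theory Num.Theory.

Local Open Scope ring_scope.

(* A finite graph is a symmetric relation [adj] on a finType.  Loops are not
   excluded: they contribute 0 to the p-Laplacian. *)

(* The empty graph does not count as connected. *)
Definition connected_graph (V : finType) (adj : rel V) : Prop :=
  (0 < #|V|)%N /\ forall i j : V, connect adj i j.

Definition vertex_measure (R : realType) (V : finType) (mu : V -> R) : Prop :=
  forall i : V, 0 < mu i.

(* Only the values of [omega] on edges are constrained or used. *)
Definition edge_measure (R : realType) (V : finType) (adj : rel V)
    (omega : V -> V -> R) : Prop :=
  forall i j : V, adj i j -> 0 < omega i j /\ omega i j = omega j i.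

(* At f j = f i the summand is 0 because of its last factor, whatever the value
   of the power (0 `^ (p - 2) is 1 for p = 2 and 0 otherwise). *)
Definition p_laplacian (R : realType) (V : finType) (adj : rel V)
    (mu : V -> R) (omega : V -> V -> R) (p : R) (f : V -> R) (i : V) : R :=
  (mu i)^-1 *
  \sum_(j | adj i j) omega i j * `|f j - f i| `^ (p - 2) * (f j - f i).

Definition average (R : realType) (V : finType) (mu f : V -> R) : R :=
  (\sum_i mu i * f i) / (\sum_i mu i).

Definition is_solution (R : realType) (V : finType) (adj : rel V)
    (mu : V -> R) (omega : V -> V -> R) (p : R) (h : V -> R) (c : R)
    (u : V -> R) : Prop :=
  forall i : V, p_laplacian adj mu omega p u i = c - h i * expR (u i).

(* Main.v *)
Require Import Defs.
From mathcomp Require Import all_boot all_order all_algebra.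
From mathcomp Require Import reals constructive_ereal sequences exp.
From mathcomp Require Import boolp classical_sets filter topology ereal.
From mathcomp Require Import normedtype derive.
From mathcomp Require Import ring lra.

(** The main tool is Perron's method of sub- and supersolutions.  Since
    t |-> |t|^(p-2) t is nondecreasing and continuous, the pointwise supremum of
    the subsolutions lying below a supersolution is a solution ([perron],
    [sub_super_solution]); on a finite vertex set no compactness is needed.

    If u solves the equation for some c < 0, multiply it by mu exp(-u) and sum
    over V.  By Green's formula the left-hand side is nonnegative, because
    exp(-u) decreases where u increases, so the integral of h is at most
    c times that of exp(-u), which is negative ([average_lt0]).

    Conversely, a solution for c is a supersolution for every c' > c, and for
    c' < 0 very negative constants are subsolutions ([solution_of_super]).
    Hence the set of c < 0 for which the equation is solvable is an interval
    with right end 0, and its infimum is the required threshold, as soon as one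
    c < 0 admits a supersolution.  When the average m of h is negative, such a
    supersolution is u = s v + ln a with a = s^(p-1), s > 0 small, where
    Delta_p v is at most m - h + delta: then Delta_p u is at most
    a (m - h + delta), while h exp(u) = a h exp(s v) with exp(s v) close to 1
    ([exists_super]).

    To find v, solve Delta_p v = f + e v with f of mean zero and e > 0 by
    Perron's method, with opposite large constants as barriers.  Summing over V
    shows that v has mean zero.  The right-hand side is bounded independently
    of e.  Summing Delta_p v over a superlevel set of v bounds every edge
    difference of v ([edge_bound]), hence the oscillation of v ([osc_bound]),
    independently of e.  As v is nonpositive somewhere, e v is at most delta for
    e small ([poisson_super]). *)

Set Implicit Arguments.
Unset Strict Implicit.
Unset Printing Implicit Defensive.

Import Order.TTheory GRing.Theory Num.Theory.
Import numFieldNormedType.Exports.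

Local Open Scope classical_set_scope.
Local Open Scope ring_scope.

(** * The signed power *)

(** The flux function t |-> |t|^(p-2) t of the p-Laplacian; its value at 0 is
    0 for every p, thanks to the last factor. *)
Definition signed_power (R : realType) (p t : R) : R := `|t| `^ (p - 2) * t.

Section SignedPower.
Variables (R : realType) (p : R).
Hypothesis p_gt1 : 1 < p.

Lemma signed_power0 : signed_power p 0 = 0.
Proof. by rewrite /signed_power mulr0. Qed.

Lemma signed_powerN t : signed_power p (- t) = - signed_power p t.
Proof. by rewrite /signed_power normrN mulrN. Qed.

Lemma signed_power_ge0E t : 0 <= t -> signed_power p t = t `^ (p - 1).
Proof.
move=> t0; rewrite /signed_power ger0_norm// mulrC.
have -> : p - 2 = p - 1 - 1 by ring.
by rewrite mulr_powRB1// subr_gt0.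
Qed.

Lemma signed_power_ge0 t : 0 <= t -> 0 <= signed_power p t.
Proof. by move=> t0; rewrite signed_power_ge0E// powR_ge0. Qed.

Lemma signed_power_le : {homo signed_power p : x y / x <= y}.
Proof.
have p1 : 0 <= p - 1 by rewrite subr_ge0 ltW.
have mono x y : 0 <= x -> x <= y -> signed_power p x <= signed_power p y.
  move=> x0 xy; have y0 := le_trans x0 xy.
  by rewrite !signed_power_ge0E//; exact: ge0_ler_powR.
move=> x y xy; have [x0|x0] := leP 0 x; first exact: mono.
rewrite -[x]opprK signed_powerN lerNl.
have [y0|y0] := leP 0 y.
  rewrite (@le_trans _ _ 0)//; first by rewrite oppr_le0 signed_power_ge0.
  by apply: signed_power_ge0; rewrite oppr_ge0 ltW.
by rewrite -signed_powerN; apply: mono; rewrite ?oppr_ge0 ?lerN2// ltW.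
Qed.

Lemma signed_power_le0 t : t <= 0 -> signed_power p t <= 0.
Proof. by move=> /signed_power_le; rewrite signed_power0. Qed.

Lemma signed_powerZ (s t : R) : 0 < s ->
  signed_power p (s * t) = s `^ (p - 1) * signed_power p t.
Proof.
move=> s0; rewrite /signed_power normrM (gtr0_norm s0) powRM// ?ltW//.
have -> : p - 2 = p - 1 - 1 by ring.
by rewrite -(@mulr_powRB1 _ s (p - 1)) ?ltW ?subr_gt0//; ring.
Qed.

Lemma signed_power_le_inv (B t : R) : 0 <= B ->
  signed_power p t <= B -> t <= B `^ (p - 1)^-1.
Proof.
move=> B0; have p1 : 0 < p - 1 by rewrite subr_gt0.
have [t0|t0 _] := leP 0 t; last by rewrite (le_trans (ltW t0))// powR_ge0.
rewrite signed_power_ge0E// => tB.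
have -> : t = (t `^ (p - 1)) `^ (p - 1)^-1.
  by rewrite -powRrM divff ?gt_eqF// powRr1.
by apply: ge0_ler_powR; rewrite ?nnegrE ?powR_ge0// invr_ge0 ltW.
Qed.

Lemma signed_power_continuous : continuous (signed_power p).
Proof.
have p1 : 0 < p - 1 by rewrite subr_gt0.
move=> t; have [->|t0] := eqVneq t 0; last first.
  apply: (@continuousM R R (fun x => `|x| `^ (p - 2)) id); last exact: cvg_id.
  apply: (@continuous_comp _ _ _ (fun x : R => `|x|) (fun x => x `^ (p - 2))).
    exact: norm_continuous.
  apply: differentiable_continuous; apply/derivable1_diffP.
  by apply: derivable_powR; rewrite in_itv/= andbT normr_gt0.
(* At 0 the factor |x|^(p-2) may blow up, but |x|^(p-1) tends to 0. *)
apply/cvgrPdist_lt => e e0; rewrite signed_power0.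
have d0 : 0 < e `^ (p - 1)^-1 by rewrite powR_gt0.
near=> x.
rewrite sub0r normrN /signed_power normrM ger0_norm ?powR_ge0//.
have -> : `|x| `^ (p - 2) * `|x| = signed_power p `|x|.
  by rewrite /signed_power normr_id.
rewrite signed_power_ge0E//.
have -> : e = (e `^ (p - 1)^-1) `^ (p - 1).
  by rewrite -powRrM mulVf ?gt_eqF// powRr1// ltW.
have xe : `|x| < e `^ (p - 1)^-1.
  by near: x; exact: (@nbhs0_lt _ R _ d0).
by apply: gt0_ltr_powR; rewrite ?nnegrE ?normr_ge0 ?powR_ge0.
Unshelve. all: by end_near.
Qed.

End SignedPower.

(** * Perron's method on a finite set *)

(** The system is F i u (u i) = 0 for all i, where the unknown of index i has
    been singled out in the i-th equation: F i is nondecreasing in the whole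
    function w and continuous in the real t, which suffices because only one
    unknown is varied at a time.  The barriers lo and hi are a subsolution and
    a supersolution. *)
Section Perron.
Variables (R : realType) (V : finType) (F : V -> (V -> R) -> R -> R).
Variables lo hi : V -> R.
Hypothesis F_le : forall i w w' t, (forall j, w j <= w' j) ->
  F i w t <= F i w' t.
Hypothesis F_cont : forall i w, continuous (F i w).
Hypothesis lo_hi : forall i, lo i <= hi i.
Hypothesis lo_sub : forall i, 0 <= F i lo (lo i).
Hypothesis hi_super : forall i, F i hi (hi i) <= 0.

Lemma perron : exists u : V -> R,
  forall i, lo i <= u i <= hi i /\ F i u (u i) = 0.
Proof.
pose S := [set w : V -> R |
  forall i, [/\ lo i <= w i, w i <= hi i & 0 <= F i w (w i)]].
have Slo : S lo by move=> i; split.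
pose E i := [set w i | w in S].
have Esup i : has_sup (E i).
  split; first by exists (lo i), lo.
  by exists (hi i) => _ [w Sw <-]; have [] := Sw i.
pose W i := sup (E i).
have W_ub w i : S w -> w i <= W i.
  by move=> Sw; apply: sup_upper_bound (Esup i) _ _; exists w.
have W_hi i : W i <= hi i.
  apply: ge_sup; first by have [] := Esup i.
  by move=> _ [w Sw <-]; have [] := Sw i.
have SW : S W.
  move=> i; split=> //; first exact: W_ub.
  rewrite leNgt; apply/negP => FW.
  have /nbhs_ballP[e /= e0 He] : \forall t \near W i, F i W t < 0.
    exact: cvgr_lt (@F_cont i W (W i)) _ FW.
  have [_ [w Sw <-] Ww] := sup_adherent e0 (Esup i).
  have [_ _ Fw] := Sw i.
  have : F i W (w i) < 0.
    apply: He; rewrite /ball/= ger0_norm ?subr_ge0 ?W_ub//.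
    by rewrite ltrBlDr -ltrBlDl.
  by rewrite ltNge (le_trans Fw)//; apply: F_le => j; apply: W_ub.
exists W => i; have [loW _ FW] := SW i; split; first by rewrite loW W_hi.
apply/eqP; rewrite eq_le FW andbT leNgt; apply/negP => FWi.
(* W cannot touch hi at i, where the supersolution inequality would hold, so
   there is room to raise W at i alone and contradict its maximality. *)
have Whi : W i < hi i.
  rewrite lt_neqAle W_hi andbT; apply/eqP => Wi; move: FWi.
  by rewrite ltNge Wi (le_trans (F_le _ _ W_hi))// hi_super.
have /nbhs_ballP[e /= e0 He] : \forall t \near W i, 0 < F i W t.
  exact: cvgr_gt (@F_cont i W (W i)) _ FWi.
pose d := Num.min (e / 2) (hi i - W i).
have d0 : 0 < d by rewrite lt_min divr_gt0// subr_gt0.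
have de : d < e by rewrite gt_min; apply/orP; left; lra.
pose W' j := if j == i then W i + d else W j.
have WW' j : W j <= W' j by rewrite /W'; case: eqP => [->|//]; lra.
have W'i : W' i = W i + d by rewrite /W' eqxx.
have W'N j : j != i -> W' j = W j by rewrite /W' => /negbTE ->.
have SW' : S W'.
  move=> j; have [loWj _ FWj] := SW j; split.
  - exact: le_trans loWj (WW' j).
  - have [->|ji] := eqVneq j i; last by rewrite W'N.
    by rewrite W'i addrC -lerBrDr ge_min lexx orbT.
  - have [->|ji] := eqVneq j i; last first.
      by rewrite [X in F _ _ X]W'N//; exact: le_trans FWj (F_le _ _ WW').
    rewrite [X in F _ _ X]W'i; apply: le_trans (F_le _ _ WW').
    by apply/ltW/He; rewrite /ball/= opprD addrA subrr sub0r normrN gtr0_norm.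
by have := W_ub _ i SW'; rewrite W'i; lra.
Qed.

End Perron.

(** * Green's formula and algebra of the p-Laplacian *)

(** Summation by parts against an antisymmetric flow [a]. *)
Lemma green (R : realType) (V : finType) (a : V -> V -> R) (g : V -> R) :
  (forall i j, a i j = - a j i) ->
  \sum_i g i * \sum_j a i j = - (\sum_i \sum_j a i j * (g j - g i)) / 2.
Proof.
move=> aN; set L := LHS.
have L1 : L = \sum_i \sum_j a i j * g i.
  by apply: eq_bigr => i _; rewrite mulr_sumr; apply: eq_bigr => j _; rewrite mulrC.
have L2 : L = - (\sum_i \sum_j a i j * g j).
  rewrite L1 exchange_big/= -sumrN; apply: eq_bigr => i _.
  by rewrite -sumrN; apply: eq_bigr => j _; rewrite aN mulNr.
have -> : \sum_i \sum_j a i j * (g j - g i) =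
    \sum_i \sum_j a i j * g j - \sum_i \sum_j a i j * g i.
  rewrite -sumrB; apply: eq_bigr => i _; rewrite -sumrB.
  by apply: eq_bigr => j _; rewrite mulrBr.
rewrite -L1; move: L2; set X := \sum_i _ => ->; lra.
Qed.

Section Graph.
Variables (R : realType) (V : finType) (adj : rel V).
Hypothesis adj_sym : symmetric adj.
Hypothesis adj_conn : connected_graph adj.
Variable mu : V -> R.
Hypothesis mu_meas : vertex_measure mu.
Variable omega : V -> V -> R.
Hypothesis omega_meas : edge_measure adj omega.
Variable p : R.
Hypothesis p_gt1 : 1 < p.

Local Notation Dp := (p_laplacian adj mu omega p).

(** The flux of the gradient of [f] along the ordered pair (i, j). *)
Let flow (f : V -> R) i j : R :=
  if adj i j then omega i j * signed_power p (f j - f i) else 0.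

Lemma mu_p_laplacian f i : mu i * Dp f i = \sum_j flow f i j.
Proof.
rewrite /p_laplacian mulVKf ?(gt_eqF (mu_meas i))//.
by rewrite -big_mkcond/=; apply: eq_bigr => j _; rewrite -mulrA.
Qed.

Lemma flowN f i j : flow f i j = - flow f j i.
Proof.
rewrite /flow adj_sym; case: ifP => [ji|_]; last by rewrite oppr0.
by have [_ ->] := omega_meas ji; rewrite -(opprB (f i)) signed_powerN mulrN.
Qed.

Lemma flow_ge0 f i j : f i <= f j -> 0 <= flow f i j.
Proof.
move=> fij; rewrite /flow; case: ifP => // /omega_meas[w0 _].
by rewrite mulr_ge0 ?(ltW w0)// signed_power_ge0// subr_ge0.
Qed.

Lemma flow_le0 f i j : f j <= f i -> flow f i j <= 0.
Proof. by move=> fij; rewrite flowN oppr_le0 flow_ge0. Qed.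

Lemma p_laplacian_green f g :
  \sum_i g i * (mu i * Dp f i) = - (\sum_i \sum_j flow f i j * (g j - g i)) / 2.
Proof.
rewrite -green; last exact: flowN.
by apply: eq_bigr => i _; rewrite mu_p_laplacian.
Qed.

Lemma sum_p_laplacian f : \sum_i mu i * Dp f i = 0.
Proof.
have := p_laplacian_green f (fun=> 1); under eq_bigr do rewrite mul1r.
move=> ->; rewrite big1 ?oppr0 ?mul0r// => i _.
by rewrite big1// => j _; rewrite subrr mulr0.
Qed.

Lemma p_laplacian_cst (c : R) i : Dp (fun=> c) i = 0.
Proof. by rewrite /p_laplacian big1 ?mulr0// => j _; rewrite subrr mulr0. Qed.

Lemma p_laplacian_affine (s b : R) (f : V -> R) i : 0 < s ->
  Dp (fun j => s * f j + b) i = s `^ (p - 1) * Dp f i.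
Proof.
move=> s0; rewrite /p_laplacian mulrCA; congr (_ * _).
rewrite mulr_sumr; apply: eq_bigr => j _.
have -> : s * f j + b - (s * f i + b) = s * (f j - f i) by ring.
rewrite -!mulrA; have := signed_powerZ p_gt1 (f j - f i) s0.
by rewrite /signed_power => ->; rewrite mulrCA.
Qed.

Lemma sum_mu_gt0 : 0 < \sum_i mu i.
Proof.
have [/card_gt0P[i _] _] := adj_conn.
rewrite (bigD1 i)//= ltr_wpDr ?(mu_meas i)// sumr_ge0// => j _.
exact: ltW (mu_meas j).
Qed.

(** * Sub- and supersolutions of the p-Laplacian *)

Lemma sub_super_solution (G : V -> R -> R) (lo hi : V -> R) :
  (forall i, continuous (G i)) -> (forall i, lo i <= hi i) ->
  (forall i, G i (lo i) <= Dp lo i) -> (forall i, Dp hi i <= G i (hi i)) ->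
  exists u : V -> R,
    forall i, lo i <= u i <= hi i /\ Dp u i = G i (u i).
Proof.
move=> Gcont lohi los his.
pose F i (w : V -> R) t :=
  \sum_(j | adj i j) omega i j * signed_power p (w j - t) - mu i * G i t.
have FE i (w : V -> R) : F i w (w i) = mu i * (Dp w i - G i (w i)).
  by rewrite mulrBr mu_p_laplacian /F big_mkcond.
have [|||||u Hu] := @perron R V F lo hi; last 1 first.
- exists u => i; have [uP /eqP] := Hu i.
  by rewrite FE mulf_eq0 (gt_eqF (mu_meas i))/= subr_eq0 => /eqP.
- move=> i w w' t ww'; rewrite lerD2r; apply: ler_sum => j ij.
  have [w0 _] := omega_meas ij.
  by rewrite ler_pM2l//; apply: signed_power_le => //; rewrite lerD2r.
- move=> i w t; rewrite /F; apply: cvgB; last first.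
    by apply: cvgM; [exact: cvg_cst|exact: Gcont].
  apply: cvg_big => [|j _]; first exact: add_continuous.
  apply: cvgM; first exact: cvg_cst.
  apply: (@continuous_comp _ _ _ (fun t : R => w j - t) (signed_power p)).
    by apply: cvgB; [exact: cvg_cst|exact: cvg_id].
  exact: signed_power_continuous.
- exact: lohi.
- by move=> i; rewrite FE mulr_ge0 ?subr_ge0// ltW.
- by move=> i; rewrite FE pmulr_rle0 ?subr_le0.
Qed.

(** * Oscillation estimate *)

(** Test the p-Laplacian against the indicator of the superlevel set
    {k | v j <= v k}: every edge crossing its boundary contributes with the same
    sign, so the single edge (i, j) is controlled by the total. *)
Lemma edge_bound (K : R) (v : V -> R) i j :
  0 <= K -> (forall k, - K <= Dp v k) -> adj i j ->
  omega i j * signed_power p (v j - v i) <= 2 * K * \sum_k mu k.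
Proof.
move=> K0 HK ij; have [w0 _] := omega_meas ij.
have [vij|vji] := leP (v j) (v i).
  apply: (@le_trans _ _ 0); last first.
    by rewrite !mulr_ge0// ltW// sum_mu_gt0.
  by rewrite pmulr_rle0// signed_power_le0// subr_le0.
pose g k : R := if v j <= v k then 1 else 0.
have H k l : 0 <= flow v k l * (g l - g k).
  rewrite /g; case: ifPn => [jl|]; case: ifPn => [jk|].
  - by rewrite subrr mulr0.
  - rewrite -ltNge => kj; rewrite subr0 mulr1 flow_ge0//.
    by rewrite (le_trans (ltW kj)).
  - rewrite -ltNge => lj; rewrite sub0r mulrN1 oppr_ge0 flow_le0//.
    by rewrite (le_trans (ltW lj)).
  - by rewrite subrr mulr0.
have gj : g j = 1 by rewrite /g lexx.
have gi : g i = 0 by rewrite /g leNgt vji.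
have -> : omega i j * signed_power p (v j - v i) = flow v i j * (g j - g i).
  by rewrite gi gj subr0 mulr1 /flow ij.
have : flow v i j * (g j - g i) <= \sum_k \sum_l flow v k l * (g l - g k).
  rewrite (bigD1 i)//= (bigD1 j)//= -addrA lerDl addr_ge0 ?sumr_ge0// => k _.
  exact: sumr_ge0.
have := p_laplacian_green v g.
have : - K * \sum_k mu k <= \sum_k g k * (mu k * Dp v k).
  rewrite mulr_sumr; apply: ler_sum => k _; have m0 := mu_meas k.
  have Km : - K * mu k <= mu k * Dp v k by rewrite mulrC ler_pM2l.
  rewrite /g; case: ifP => _; rewrite ?mul1r ?mul0r//.
  by rewrite mulNr oppr_le0 mulr_ge0// ltW.
set A := \sum_k g k * _; set B := \sum_k mu k; set Y := \sum_k \sum_l _.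
rewrite mulNr -[2 * K * B]mulrA; set KB := K * B; lra.
Qed.

Lemma path_bound D (v : V -> R) : (forall i j, adj i j -> v j - v i <= D) ->
  forall s i, path adj i s -> v (last i s) - v i <= D *+ size s.
Proof.
move=> HD; elim=> [|j s IH] i /=; first by rewrite subrr mulr0n.
by move=> /andP[/HD ij /IH js]; rewrite mulrS; lra.
Qed.

(** A function whose p-Laplacian is bounded below has bounded oscillation,
    with a bound that does not depend on the function. *)
Lemma osc_bound (K : R) : 0 <= K -> exists2 C, 0 <= C &
  forall v, (forall i, - K <= Dp v i) -> forall i j, v j - v i <= C.
Proof.
move=> K0; pose B i j := 2 * K * (\sum_k mu k) / omega i j.
pose D := \sum_i \sum_j B i j `^ (p - 1)^-1.
have D0 : 0 <= D by do 2! apply: sumr_ge0 => ? _; exact: powR_ge0.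
exists (D *+ #|V|); first by rewrite mulrn_wge0.
move=> v Hv i j; have [_ conn] := adj_conn.
(* A simple path has at most #|V| edges. *)
have [s /shortenP[s' s'p us' _] ->] := connectP (conn i j).
have {}s'p : v (last i s') - v i <= D *+ size s'.
  apply: path_bound s'p => k l kl; have [w0 _] := omega_meas kl.
  have Bkl : signed_power p (v l - v k) <= B k l.
    by rewrite ler_pdivlMr// mulrC; apply: edge_bound.
  have B0 : 0 <= B k l.
    by rewrite divr_ge0 ?(ltW w0)// !mulr_ge0// ltW// sum_mu_gt0.
  apply: le_trans (signed_power_le_inv p_gt1 B0 Bkl) _.
  rewrite /D (bigD1 k)//= (bigD1 l)//= -addrA lerDl addr_ge0//.
    by apply: sumr_ge0 => ? _; exact: powR_ge0.
  by do 2! apply: sumr_ge0 => ? _; exact: powR_ge0.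
apply: le_trans s'p _; apply: ler_wpMn2l => //.
by have /card_uniqP := us' => /= h; apply: ltnW; rewrite -h max_card.
Qed.

(** * The Poisson equation up to a small error *)

(** Supersolutions of Delta_p v = f with an arbitrarily small error suffice
    below, and they avoid passing to the limit e -> 0 in
    Delta_p v = f + e v. *)
Lemma poisson_super (f : V -> R) (delta : R) :
  \sum_i mu i * f i = 0 -> 0 < delta ->
  exists v : V -> R, forall i, Dp v i <= f i + delta.
Proof.
move=> f0 d0; pose M := \sum_i `|f i|.
have M0 : 0 <= M by apply: sumr_ge0.
have fM i : `|f i| <= M by rewrite /M (bigD1 i)//= lerDl sumr_ge0.
have [|C C0 HC] := @osc_bound (2 * M); first by rewrite mulr_ge0.
pose e := delta / (C + 1); have e0 : 0 < e by rewrite divr_gt0// ltr_wpDl.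
have eMe : e * (M / e) = M by rewrite mulrC divfK ?gt_eqF.
have [||||v Hv] := @sub_super_solution (fun i t => f i + e * t)
    (fun=> - (M / e)) (fun=> M / e).
- move=> i t; apply: cvgD; first exact: cvg_cst.
  by apply: cvgM; [exact: cvg_cst|exact: cvg_id].
- by move=> i; have := divr_ge0 M0 (ltW e0); lra.
- move=> i; rewrite p_laplacian_cst mulrN eMe.
  by have := fM i; rewrite ler_norml => /andP[]; lra.
- move=> i; rewrite p_laplacian_cst eMe.
  by have := fM i; rewrite ler_norml => /andP[]; lra.
exists v => i.
have Kv k : - (2 * M) <= Dp v k.
  have [/andP[vk _] ->] := Hv k; have := fM k; rewrite ler_norml => /andP[fk _].
  have : e * - (M / e) <= e * v k by rewrite ler_pM2l.
  by rewrite mulrN eMe; lra.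
have sv : \sum_k mu k * v k = 0.
  have := sum_p_laplacian v.
  under eq_bigr do rewrite (Hv _).2 mulrDr mulrCA.
  rewrite big_split/= f0 add0r -mulr_sumr => /eqP.
  by rewrite mulf_eq0 (gt_eqF e0)/= => /eqP.
have [k vk] : exists k, v k <= 0.
  apply: contrapT => /forallNP vpos.
  have vp k : 0 < v k by rewrite ltNge; apply/negP/vpos.
  move: sv; rewrite (bigD1 i)//= => /eqP; rewrite gt_eqF//.
  apply: ltr_wpDr; last by rewrite mulr_gt0.
  by apply: sumr_ge0 => k _; rewrite mulr_ge0// ltW.
rewrite (Hv i).2 lerD2l.
have vC : v i <= C + 1 by have := HC v Kv k i; lra.
by rewrite mulrC -ler_pdivlMr// /e invfM invrK mulrA divff ?mul1r// gt_eqF.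
Qed.

(** * The Kazdan-Warner equation *)

Lemma average_lt0 (h : V -> R) (c : R) (u : V -> R) :
  c < 0 -> is_solution adj mu omega p h c u -> average mu h < 0.
Proof.
move=> c0 Hu; rewrite /average pmulr_llt0 ?invr_gt0 ?sum_mu_gt0//.
have := p_laplacian_green u (fun i => expR (- u i)).
have -> : \sum_i expR (- u i) * (mu i * Dp u i) =
    c * (\sum_i mu i * expR (- u i)) - \sum_i mu i * h i.
  rewrite mulr_sumr -sumrB; apply: eq_bigr => i _.
  have EE := expRxMexpNx_1 (u i).
  by rewrite Hu mulrCA mulrBr (mulrCA _ (h i)) [_ * expR (u i)]mulrC EE; ring.
set X := \sum_i \sum_j _.
have X0 : X <= 0.
  apply: sumr_le0 => i _; apply: sumr_le0 => j _.
  have [uij|/ltW uji] := leP (u i) (u j).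
    by rewrite mulr_ge0_le0 ?flow_ge0// subr_le0 ler_expR lerN2.
  by rewrite mulr_le0_ge0 ?flow_le0// subr_ge0 ler_expR lerN2.
have : 0 < \sum_i mu i * expR (- u i).
  have [/card_gt0P[i _] _] := adj_conn.
  rewrite (bigD1 i)//= ltr_wpDr ?mulr_gt0 ?expR_gt0// sumr_ge0// => j _.
  by rewrite mulr_ge0 ?expR_ge0// ltW.
by rewrite -(nmulr_rlt0 _ c0); lra.
Qed.

(** The barrier from below is a constant, which is a subsolution once it is
    negative enough; this is where c < 0 is needed. *)
Lemma solution_of_super (h : V -> R) (c : R) (u : V -> R) : c < 0 ->
  (forall i, Dp u i <= c - h i * expR (u i)) ->
  exists w, is_solution adj mu omega p h c w.
Proof.
move=> c0 Hu.
pose H := 1 + \sum_i `|h i|.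
have H0 : 0 < H by rewrite ltr_pwDl// sumr_ge0.
pose a := Num.min (ln (- c / H)) (- \sum_i `|u i|).
have au i : a <= u i.
  rewrite ge_min; apply/orP; right; rewrite lerNl.
  apply: (@le_trans _ _ `|u i|); first by rewrite -normrN ler_norm.
  by rewrite (bigD1 i)//= lerDl sumr_ge0.
have ha i : h i * expR a >= c.
  have hH : - h i <= H.
    apply: (@le_trans _ _ `|h i|); first by rewrite -normrN ler_norm.
    by rewrite /H (bigD1 i)//= addrCA lerDl addr_ge0// sumr_ge0.
  have ac : H * expR a <= - c.
    have cH : 0 < - c / H by rewrite divr_gt0// oppr_gt0.
    by rewrite mulrC -ler_pdivlMr// -[leRHS]lnK// ler_expR ge_min lexx.
  have : - h i * expR a <= H * expR a by rewrite ler_pM2r ?expR_gt0.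
  by rewrite mulNr; lra.
have [||||w Hw] := @sub_super_solution (fun i t => c - h i * expR t)
    (fun=> a) u.
- move=> i t; apply: cvgB; first exact: cvg_cst.
  by apply: cvgM; [exact: cvg_cst|exact: continuous_expR].
- exact: au.
- by move=> i; rewrite p_laplacian_cst; have := ha i; lra.
- exact: Hu.
by exists w => i; have [] := Hw i.
Qed.

Lemma exists_super (h : V -> R) : average mu h < 0 -> exists2 c, c < 0 &
  exists u, forall i, Dp u i <= c - h i * expR (u i).
Proof.
set m := average mu h => m0.
have mE : \sum_i mu i * (m - h i) = 0.
  under eq_bigr do rewrite mulrBr.
  by rewrite sumrB -mulr_suml mulrC divfK ?subrr// gt_eqF// sum_mu_gt0.
have [|v Hv] := poisson_super (delta := - m / 2) mE.
  by rewrite divr_gt0// oppr_gt0.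
(* Delta_p v <= m / 2 - h leaves the margin m / 2 < 0, half of which goes to
   this error term and half to c = a m / 4. *)
have [s s0 Hs] : exists2 s, 0 < s &
    forall i, h i * (expR (s * v i) - 1) < - m / 4.
  have : \forall s \near 0^'+,
      forall i, h i * (expR (s * v i) - 1) < - m / 4.
    apply: filter_forall => i.
    apply: (@cvgr_lt _ _ _ _ _ (h i * (expR (0 * v i) - 1))); last first.
      by rewrite mul0r expR0 subrr mulr0 divr_gt0// oppr_gt0.
    apply: cvg_at_right_filter.
    apply: cvgM; first exact: cvg_cst.
    apply: cvgB; last exact: cvg_cst.
    apply: (@continuous_comp _ _ _ (fun s : R => s * v i) (@expR R)).
      by apply: cvgM; [exact: cvg_id|exact: cvg_cst].
    exact: continuous_expR.
  move=> Hs; near (0 : R)^'+ => s; exists s => //.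
  by near: s.
(* By homogeneity, exp (s v + ln a) = a exp (s v) has the same factor a as
   Delta_p (s v). *)
pose a := s `^ (p - 1); have a0 : 0 < a by rewrite powR_gt0.
exists (a * (m / 4)); first by rewrite pmulr_rlt0//; lra.
exists (fun i => s * v i + ln a) => i.
rewrite p_laplacian_affine// -/a expRD lnK ?posrE//.
have -> : a * (m / 4) - h i * (expR (s * v i) * a) =
  a * (m / 4 - h i * expR (s * v i)) by ring.
by rewrite ler_pM2l//; have := Hv i; have := Hs i; lra.
Unshelve. all: by end_near.
Qed.

End Graph.

Theorem theorem2p5 (R : realType) (V : finType) (adj : rel V)
    (adj_sym : symmetric adj) (adj_conn : connected_graph adj)
    (mu : V -> R) (mu_meas : vertex_measure mu)
    (omega : V -> V -> R) (omega_meas : edge_measure adj omega)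
    (p : R) (p_gt1 : 1 < p) (h : V -> R) :
  ((exists2 c : R, c < 0 &
      exists u : V -> R, is_solution adj mu omega p h c u) ->
    average mu h < 0) /\
  (average mu h < 0 ->
    exists cm : \bar R,
      [/\ (cm < 0)%E,
          forall c : R, (cm < c%:E)%E -> c < 0 ->
            exists u : V -> R, is_solution adj mu omega p h c u
        & forall c : R, (c%:E < cm)%E ->
            ~ exists u : V -> R, is_solution adj mu omega p h c u]).
Proof.
split=> [[c c0 [u Hu]]|h0]; first exact: average_lt0 Hu.
pose S := [set c%:E | c in [set c : R | c < 0 /\
  exists u, is_solution adj mu omega p h c u]].
have [c0 c00 [u0 Hu0]] :=
  exists_super adj_sym adj_conn mu_meas omega_meas p_gt1 h0.
have Sc0 : S c0%:E.
  by exists c0 => //; split=> //; apply: solution_of_super Hu0.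
have cm0 : (ereal_inf S < 0)%E.
  by apply: (le_lt_trans (ereal_inf_lbound Sc0)); rewrite lte_fin.
exists (ereal_inf S); split=> // c.
- move=> /ereal_inf_lt[_ [d [d0 [u Hu]] <-]]; rewrite lte_fin => dc c_lt0.
  apply: (@solution_of_super _ _ _ _ mu_meas _ omega_meas _ p_gt1 _ _ u) => // i.
  by rewrite Hu lerD2r ltW.
- move=> ccm [u Hu].
  have c_lt0 : c < 0 by rewrite -lte_fin (lt_trans ccm).
  have Sc : S c%:E by exists c => //; split=> //; exists u.
  by move: ccm; rewrite ltNge ereal_inf_lbound.
Qed.
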